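(* Let $S\subseteq\{0,1\}^n$ be an up-monotone cube-ideal set-system with connectivity $\lambda\geq1$. Then $S$ has VC dimension at least $(1-1/\lambda)n$.
   Context: A set-system is a subset $S\subseteq\{0,1\}^n$ with convex hull $\mathrm{conv}(S)$. It is up-monotone if $p\geq q$ (coordinatewise) with $p,q\in\{0,1\}^n$ and $q\in S$ imply $p\in S$. A GSC inequality is $\sum_{i\in I}x_i+\sum_{j\in J}(1-x_j)\geq1$ for disjoint $I,J\subseteq[n]$, using $|I|+|J|$ variables; capacity inequalities are $x_i\geq0$, $x_i\leq1$. $S$ is cube-ideal if $\mathrm{conv}(S)$ is the solution set of a finite family of capacity and GSC inequalities. The connectivity of $S$ is the minimum number of variables in a GSC inequality valid for $\mathrm{conv}(S)$ ($+\infty$ if $S=\{0,1\}^n$, with $1/\lambda$ then read as $0$). The VC dimension of $S$ is the largest $d$ such that for some $I\subseteq[n]$ with $|I|=d$, the restrictions $\{p_I:p\in S\}$ give all of $\{0,1\}^I$ ($0$ if $S=\emptyset$). *)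

(* Defs.v *)
From mathcomp Require Import all_boot all_order all_algebra.
From mathcomp Require Import all_classical all_reals ereal.

Set Implicit Arguments.
Unset Strict Implicit.
Unset Printing Implicit Defensive.

Import Order.TTheory GRing.Theory Num.Theory.
Local Open Scope ring_scope.
Local Open Scope classical_set_scope.

Definition cube (n : nat) : finType := {ffun 'I_n -> bool}.

Definition setsystem (n : nat) : Type := {set cube n}.

Definition up_monotone (n : nat) (S : setsystem n) : Prop :=
  forall p q : cube n, (forall i, (q i <= p i)%N) -> q \in S -> p \in S.

Definition vertex (R : realType) (n : nat) (p : cube n) : 'rV[R]_n :=
  \row_i (p i)%:R.

Definition conv_hull (R : realType) (n : nat) (S : setsystem n) : set 'rV[R]_n :=
  [set x | exists w : cube n -> R,
     [/\ forall p, p \in S -> 0 <= w p,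
         \sum_(p in S) w p = 1
       & x = \sum_(p in S) w p *: vertex R p]].
Arguments conv_hull R {n} S.

(* [GSC A B] is only meant for disjoint [A] and [B]; see [wf_ineq]. *)
Inductive ineq (n : nat) : Type :=
  | CapLower of 'I_n
  | CapUpper of 'I_n
  | GSC of {set 'I_n} & {set 'I_n}.

Definition wf_ineq (n : nat) (c : ineq n) : bool :=
  if c is GSC A B then [disjoint A & B] else true.

Definition satisfies (R : realType) (n : nat) (x : 'rV[R]_n) (c : ineq n)
    : bool :=
  match c with
  | CapLower i => 0 <= x 0 i
  | CapUpper i => x 0 i <= 1
  | GSC A B => \sum_(i in A) x 0 i + \sum_(j in B) (1 - x 0 j) >= 1
  end.

Definition cube_ideal (R : realType) (n : nat) (S : setsystem n) : Prop :=
  exists F : seq (ineq n),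
    all (@wf_ineq n) F /\ conv_hull R S = [set x | all (satisfies x) F].

Definition valid (R : realType) (n : nat) (S : setsystem n) (c : ineq n)
    : Prop :=
  forall x : 'rV[R]_n, conv_hull R S x -> satisfies x c.

(* The value is [+oo] when no GSC inequality is valid, i.e. when [S] is the
   whole cube; it is [0] when [S] is empty, as [GSC set0 set0] reads 0 >= 1. *)
Definition connectivity (R : realType) (n : nat) (S : setsystem n) : \bar R :=
  \big[Order.min/+oo%E]_(IJ : {set 'I_n} * {set 'I_n} |
      [disjoint IJ.1 & IJ.2] && `[< valid R S (GSC IJ.1 IJ.2) >])
    ((#|IJ.1| + #|IJ.2|)%:R)%:E.

Definition restriction (n : nat) (I : {set 'I_n}) (p : cube n)
    : {ffun {i : 'I_n | i \in I} -> bool} :=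
  [ffun i => p (val i)].

Definition shattered (n : nat) (S : setsystem n) (I : {set 'I_n}) : bool :=
  [set restriction I p | p in S]%SET
    == [set: {ffun {i : 'I_n | i \in I} -> bool}]%SET.

Definition VCdim (n : nat) (S : setsystem n) : nat :=
  \max_(I : {set 'I_n} | shattered S I) #|I|.

(* Main.v *)
Require Import Defs.
From mathcomp Require Import all_boot all_order all_algebra.
From mathcomp Require Import all_classical all_reals ereal.
Import Order.TTheory GRing.Theory Num.Theory.
Local Open Scope ring_scope.

(** Write [lambda] for the connectivity and [c = 1/lambda]. For an up-monotone
    [S], a valid inequality [GSC A B] can be strengthened to the valid
    inequality [GSC A set0], so [A] has at least [lambda] elements. Hence the
    constant vector [c] satisfies every inequality describing [conv S], i.e. it
    is a convex combination of points of [S]; one of these has at most [c * n]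
    ones. By up-monotonicity the set of its zeros is shattered. *)

Section UpMonotone.
Context {R : realType} {n : nat}.
Implicit Types (S : setsystem n) (p : cube n) (A B : {set 'I_n}).

Lemma conv_hull_vertex S p : p \in S -> conv_hull R S (vertex R p).
Proof.
move=> pS; exists (fun q => (q == p)%:R); split=> [q _||].
- by rewrite ler0n.
- by rewrite (bigD1 p) //= eqxx big1 ?addr0 // => q /andP[_ /negPf ->].
- rewrite (bigD1 p) //= eqxx scale1r big1 ?addr0 // => q /andP[_ /negPf ->].
  by rewrite scale0r.
Qed.

Lemma sum_convex_combination S A (w : cube n -> R) :
  \sum_(i in A) (\sum_(p in S) w p *: vertex R p) 0 i
  = \sum_(p in S) w p * #|[set i in A | p i]%SET|%:R.
Proof.
under eq_bigr do rewrite summxE.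
rewrite exchange_big /=; apply: eq_bigr => p _.
under eq_bigr do rewrite !mxE.
rewrite -mulr_sumr -sum1_card natr_sum; congr (_ * _).
rewrite [RHS](eq_bigl (fun i => (i \in A) && p i)); last by move=> i; rewrite inE.
by rewrite big_mkcondr; apply: eq_bigr => i _; case: (p i).
Qed.

(** At a convex combination of points of [S], the left-hand side is the weighted average of the
    numbers of ones that these points have in [A], each of which is at least 1. *)
Lemma valid_GSC_set0 S A :
  (forall p, p \in S -> exists2 i, i \in A & p i) -> valid R S (GSC A finset.set0).
Proof.
move=> hA _ [w [w0 w1 ->]] /=; rewrite big_set0 addr0 sum_convex_combination.
rewrite -[leLHS]w1; apply: ler_sum => p pS; apply: ler_peMr; first exact: w0.
rewrite ler1n card_gt0.
have [i iA pi] := hA p pS.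
by apply/set0Pn; exists i; rewrite inE iA.
Qed.

Lemma valid_GSC_up_monotone S A B : up_monotone S -> [disjoint A & B] ->
  valid R S (GSC A B) -> valid R S (GSC A finset.set0).
Proof.
move=> hup dAB vAB; apply: valid_GSC_set0 => p pS.
apply: contrapT => noA.
(* If [p] vanishes on [A], raising it to 1 on [B] stays in [S] and leaves it 0 on [A] by
   disjointness, so the left-hand side of [GSC A B] is 0 at [q]. *)
pose q : cube n := [ffun i => p i || (i \in B)].
have qS : q \in S by apply: hup pS => i; rewrite ffunE; case: (p i).
have := vAB _ (conv_hull_vertex S q qS).
rewrite /= !big1 ?addr0 ?ler10 // => i iX; rewrite !mxE ffunE.
  by rewrite iX orbT subrr.
rewrite (disjointFr dAB iX) orbF; case: (boolP (p i)) => // pi.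
by case: noA; exists i.
Qed.

(** The coordinate sum [c * n] is a weighted average of the numbers of ones of points of [S], so the
    minimum of these numbers is at most [c * n]. *)
Lemma exists_light_point S (c : R) :
  conv_hull R S (const_mx c) ->
  exists2 p, p \in S & #|[set i | p i]%SET|%:R <= c * n%:R.
Proof.
move=> [w [w0 w1 cE]].
have [p0 p0S] : exists p, p \in S.
  apply/set0Pn; apply/eqP => S0; move/eqP: w1.
  by rewrite S0 big_set0 eq_sym oner_eq0.
case: (arg_minnP (fun p => #|[set i | p i]%SET|) p0S) => p pS pmin.
exists p => //.
have -> : c * n%:R = \sum_(i in [set: 'I_n]%SET) (const_mx c : 'rV[R]_n) 0 i.
  under eq_bigr do rewrite mxE.
  by rewrite sumr_const cardsT card_ord mulr_natr.
rewrite cE sum_convex_combination -[leLHS]mul1r -[X in X * _ <= _]w1 mulr_suml.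
apply: ler_sum => q qS; rewrite ler_wpM2l ?w0 // ler_nat.
rewrite [X in (_ <= X)%N](_ : _ = #|[set i | q i]%SET|) ?pmin //.
by apply: eq_card => i; rewrite !inE.
Qed.

Lemma shattered_zeros S p : up_monotone S -> p \in S ->
  shattered S [set i | ~~ p i]%SET.
Proof.
move=> hup pS; apply/eqP/setP => f; rewrite inE.
(* Extending the pattern [f] by ones off the zeros of [p] gives a point above [p]. *)
pose q : cube n := [ffun i => if insub i is Some j then f j else true].
apply/imsetP; exists q.
  apply: hup pS => i; rewrite ffunE.
  by case: insubP => [j|]; rewrite inE ?negbK; case: (p i).
by apply/ffunP => j; rewrite !ffunE valK.
Qed.

(** A real weight [c] covers both finite connectivity, with [c] its inverse, and infinite
    connectivity, with [c = 0]. *)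
Lemma VCdim_ge_of_GSC_weight S (c : R) : up_monotone S -> cube_ideal R S ->
  0 <= c <= 1 ->
  (forall A B, [disjoint A & B] -> valid R S (GSC A B) ->
     1 <= c * (#|A| + #|B|)%:R) ->
  (1 - c) * n%:R <= (VCdim S)%:R.
Proof.
move=> hup [F [wfF convE]] /andP[c0 c1] hc.
have /exists_light_point[p pS pc] : conv_hull R S (const_mx c).
  pose e0 : ineq n := GSC finset.set0 finset.set0.
  rewrite convE /=; apply/(all_nthP e0) => k kF.
  have := all_nthP e0 wfF k kF.
  have : valid R S (nth e0 F k).
    by move=> x; rewrite convE /= => /(all_nthP e0); apply.
  case: (nth e0 F k) => [i|i|A B] /=; rewrite ?mxE // => vAB dAB.
  have := hc A finset.set0 _ (valid_GSC_up_monotone S A B hup dAB vAB).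
  rewrite cards0 addn0 => /(_ _)/le_trans; apply.
    by rewrite disjoint_sym finset.disjoints_subset finset.sub0set.
  (* The sum over [A] is already at least 1, and the terms [1 - c] over [B] are nonnegative. *)
  rewrite (eq_bigr (fun=> c)) => [|i _]; last by rewrite mxE.
  rewrite sumr_const mulr_natr lerDl sumr_ge0 // => i _.
  by rewrite mxE subr_ge0.
have : (n - #|[set i | p i]%SET| <= VCdim S)%N.
  apply: leq_trans (leq_bigmax_cond _ (shattered_zeros S p hup pS)).
  rewrite -[n in (n - _)%N]card_ord -(cardsC [set i | p i]%SET).
  by rewrite addKn; apply/eq_leq/eq_card => i; rewrite !inE.
rewrite -(ler_nat R) => /(le_trans _); apply.
rewrite natrB ?mulrBl ?mul1r ?lerB //.
by rewrite -[X in (_ <= X)%N]card_ord max_card.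
Qed.

End UpMonotone.

Lemma connectivity_le (R : realType) (n : nat) (S : setsystem n)
    (A B : {set 'I_n}) : [disjoint A & B] -> valid R S (GSC A B) ->
  (connectivity R S <= ((#|A| + #|B|)%:R)%:E)%E.
Proof.
move=> dAB vAB; apply: (bigmin_le_cond _ (j := (A, B))).
by rewrite /= dAB; apply/asboolP.
Qed.

(* In extended-real arithmetic [+oo^-1 = 0]. *)
Theorem theorem5p2 (R : realType) (n : nat) (S : setsystem n)
    (hup : up_monotone S) (hideal : cube_ideal R S)
    (hconn : (1 <= connectivity R S)%E) :
  ((1 - (connectivity R S)^-1) * n%:R%:E <= (VCdim S)%:R%:E)%E.
Proof.
have := @connectivity_le R n S.
case: (connectivity R S) hconn => [r r1 hle|_ hle|//].
- have {}r1 : 1 <= r by rewrite lee_fin in r1.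
  have r0 : 0 < r by apply: lt_le_trans r1.
  rewrite inver (gt_eqF r0) -EFinB -EFinM lee_fin.
  apply: VCdim_ge_of_GSC_weight => //; first by rewrite invr_ge0 ltW //= invf_le1.
  by move=> A B dAB /(hle _ _ dAB); rewrite lee_fin ler_pdivlMl // mulr1.
(* With connectivity [+oo], no GSC inequality is valid, so the weight condition holds vacuously for
   [c = 0]. *)
- rewrite invey sube0 mul1e lee_fin -[leLHS]mul1r -[X in X * _]subr0.
  apply: VCdim_ge_of_GSC_weight => //; first by rewrite lexx ler01.
  by move=> A B dAB /(hle _ _ dAB).
Qed.
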